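(* The following are equivalent for every idempotent algebra $\mathbf{A}$. (1) $\mathbf{A}$ is a Taylor algebra. (2) $\mathbf{A}$ has a double loop term. (3) $\mathbf{A}$ has a strong double loop term. (4) $\mathbf{A}$ has a weak 3-cube term. (5) There are $4$-ary terms $q_1,q_2$ and a ternary term $c$ in $\mathbf{A}$ satisfying \[ q_1(x,y,x,y)\approx q_1(y,x,x,y)\approx q_2(x,y,x,y)\approx q_2(y,x,x,y), \] \[ q_1(x,x,y,y)\approx c(x,y,x),\qquad q_2(x,x,y,y)\approx c(y,x,x). \] (6) $\mathbf{A}$ has terminator terms. (7) $\mathbf{A}$ has strong terminator terms.
   Context: Algebras have purely algebraic signatures (operation symbols of finite arities). An algebra is idempotent if each of its basic operations $f$ satisfies $f(a,a,\dots,a)=a$ for all elements $a$. An algebra satisfies an equation $s\approx t$ if both terms evaluate to the same element under every evaluation of the variables. Taylor algebras: An equational condition $\mathcal{S}$ is a system of equations in some signature $\Delta$. An algebra $\mathbf{A}$ of a signature $\Sigma$ satisfies $\mathcal{S}$ if one can replace each operation symbol in $\Delta$ by a term in the signature $\Sigma$ (of the same arity) so that all equations of $\mathcal{S}$ become satisfied in $\mathbf{A}$. An equational condition is trivial if it is satisfied in every algebra (equivalently, in an algebra in the empty signature with at least two elements), and nontrivial otherwise. It is idempotent if for each operation symbol $f$ appearing in it, the equation $f(x,\dots,x)\approx x$ is a consequence of its equations. An algebra is called Taylor if it satisfies a nontrivial idempotent equational condition. In each of the following, the displayed equations are required to be satisfied in $\mathbf{A}$. Double loop term: a $12$-ary term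 $d$ with \[ d(x,x,x,x,x,x,y,y,y,y,y,y)\approx d(x,x,y,y,y,y,x,x,x,x,y,y), \] \[ d(x,y,x,x,y,y,x,x,y,y,x,y)\approx d(y,x,x,y,x,y,x,y,x,y,y,x). \] Strong double loop term: a $12$-ary term $d$ for which all four expressions are equal: \[ d(x,x,x,x,x,x,y,y,y,y,y,y)\approx d(x,x,y,y,y,y,x,x,x,x,y,y)\approx d(x,y,x,x,y,y,x,x,y,y,x,y)\approx d(y,x,x,y,x,y,x,y,x,y,y,x). \] Weak 3-cube term: a $6$-ary term $t$ with \[ t(x,y,y,y,x,x)\approx t(y,x,y,x,y,x)\approx t(y,y,x,x,x,y). \] Terminator terms: ternary terms $c,c_1,c_2,c_{11},c_{12},c_{21},c_{22}$ with \[ c(x,y,x)\approx c_1(x,x,y),\qquad c(y,x,x)\approx c_2(x,x,y), \] and, for each $i\in\{1,2\}$, \[ c_i(x,y,x)\approx c_{i1}(x,x,y),\quad c_i(y,x,x)\approx c_{i2}(x,x,y),\quad c_{i1}(x,y,x)\approx c_{i2}(x,y,x),\quad c_{i1}(y,x,x)\approx c_{i2}(y,x,x). \] Strong terminator terms: terminator terms that moreover satisfy $c_{11}(y,x,x)\approx c_{22}(x,y,x)$. *)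

(* Defs.v *)
From mathcomp Require Import all_boot.

Set Implicit Arguments.
Unset Strict Implicit.
Unset Printing Implicit Defensive.

Record signature := Signature { symbol :> Type; arity : symbol -> nat }.

(* The carrier is an arbitrary type, possibly empty. *)
Record algebra (Sg : signature) := Algebra {
  carrier :> Type;
  op : forall f : Sg, {ffun 'I_(arity f) -> carrier} -> carrier }.

(* An n-ary term is a term whose variables are taken in 'I_n. *)
Inductive term (Sg : signature) (V : Type) :=
| Var of V
| App (f : Sg) of {ffun 'I_(arity f) -> term Sg V}.

Fixpoint eval (Sg : signature) (A : algebra Sg) (V : Type) (e : V -> A)
    (t : term Sg V) : A :=
  match t with
  | Var v => e v
  | App f ts => op [ffun i => eval e (ts i)]
  end.

Fixpoint subst (Sg : signature) (V W : Type) (s : V -> term Sg W)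
    (t : term Sg V) : term Sg W :=
  match t with
  | Var v => s v
  | App f ts => App [ffun i => subst s (ts i)]
  end.

Definition satisfies (Sg : signature) (A : algebra Sg) (V : Type)
    (s t : term Sg V) : Prop :=
  forall e : V -> A, eval e s = eval e t.

Definition idempotent_algebra (Sg : signature) (A : algebra Sg) : Prop :=
  forall (f : Sg) (a : A), op (f := f) [ffun=> a] = a.

(* A possibly infinite set of equations s ~ t, as a binary relation on terms.
   Each equation involves finitely many variables, so nat provides enough. *)
Definition condition (Dl : signature) := term Dl nat -> term Dl nat -> Prop.

Definition interpretation (Dl Sg : signature) :=
  forall f : Dl, term Sg 'I_(arity f).

Fixpoint translate (Dl Sg : signature) (I : interpretation Dl Sg) (V : Type)
    (t : term Dl V) : term Sg V :=
  match t with
  | Var v => Var Sg v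
  | App f ts => subst (fun i => translate I (ts i)) (I f)
  end.

Definition satisfies_condition (Sg : signature) (A : algebra Sg)
    (Dl : signature) (S : condition Dl) : Prop :=
  exists I : interpretation Dl Sg,
    forall s t, S s t -> satisfies A (translate I s) (translate I t).

Definition trivial_condition (Dl : signature) (S : condition Dl) : Prop :=
  forall (Sg : signature) (A : algebra Sg), satisfies_condition A S.

Definition consequence (Dl : signature) (S : condition Dl)
    (s t : term Dl nat) : Prop :=
  forall B : algebra Dl,
    (forall u v, S u v -> satisfies B u v) -> satisfies B s t.

Fixpoint occurs (Sg : signature) (V : Type) (f : Sg) (t : term Sg V) : Prop :=
  match t with
  | Var _ => False
  | App g ts => g = f \/ exists i, occurs f (ts i)
  end.

Definition appears (Dl : signature) (S : condition Dl) (f : Dl) : Prop :=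
  exists s t, S s t /\ (occurs f s \/ occurs f t).

Definition idempotent_condition (Dl : signature) (S : condition Dl) : Prop :=
  forall f : Dl, appears S f ->
    consequence S (App (f := f) [ffun=> Var Dl 0]) (Var Dl 0).

Definition taylor (Sg : signature) (A : algebra Sg) : Prop :=
  exists (Dl : signature) (S : condition Dl),
    [/\ idempotent_condition S, ~ trivial_condition S
      & satisfies_condition A S].

Definition tval (Sg : signature) (A : algebra Sg) (n : nat)
    (t : term Sg 'I_n) (a : n.-tuple A) : A := eval (tnth a) t.

Definition has_double_loop_term (Sg : signature) (A : algebra Sg) : Prop :=
  exists d : term Sg 'I_12, forall x y : A,
    tval d [tuple x; x; x; x; x; x; y; y; y; y; y; y]
      = tval d [tuple x; x; y; y; y; y; x; x; x; x; y; y] /\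
    tval d [tuple x; y; x; x; y; y; x; x; y; y; x; y]
      = tval d [tuple y; x; x; y; x; y; x; y; x; y; y; x].

Definition has_strong_double_loop_term (Sg : signature) (A : algebra Sg)
    : Prop :=
  exists d : term Sg 'I_12, forall x y : A,
    [/\ tval d [tuple x; x; x; x; x; x; y; y; y; y; y; y]
          = tval d [tuple x; x; y; y; y; y; x; x; x; x; y; y],
        tval d [tuple x; x; y; y; y; y; x; x; x; x; y; y]
          = tval d [tuple x; y; x; x; y; y; x; x; y; y; x; y]
      & tval d [tuple x; y; x; x; y; y; x; x; y; y; x; y]
          = tval d [tuple y; x; x; y; x; y; x; y; x; y; y; x]].

Definition has_weak_3cube_term (Sg : signature) (A : algebra Sg) : Prop :=
  exists t : term Sg 'I_6, forall x y : A,
    tval t [tuple x; y; y; y; x; x] = tval t [tuple y; x; y; x; y; x] /\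
    tval t [tuple y; x; y; x; y; x] = tval t [tuple y; y; x; x; x; y].

Definition has_linked_quaternary_terms (Sg : signature) (A : algebra Sg)
    : Prop :=
  exists (q1 q2 : term Sg 'I_4) (c : term Sg 'I_3), forall x y : A,
    [/\ tval q1 [tuple x; y; x; y] = tval q1 [tuple y; x; x; y],
        tval q1 [tuple y; x; x; y] = tval q2 [tuple x; y; x; y],
        tval q2 [tuple x; y; x; y] = tval q2 [tuple y; x; x; y],
        tval q1 [tuple x; x; y; y] = tval c [tuple x; y; x]
      & tval q2 [tuple x; x; y; y] = tval c [tuple y; x; x]].

Definition terminator_branch (Sg : signature) (A : algebra Sg)
    (ci ci1 ci2 : term Sg 'I_3) : Prop :=
  forall x y : A,
    [/\ tval ci [tuple x; y; x] = tval ci1 [tuple x; x; y],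
        tval ci [tuple y; x; x] = tval ci2 [tuple x; x; y],
        tval ci1 [tuple x; y; x] = tval ci2 [tuple x; y; x]
      & tval ci1 [tuple y; x; x] = tval ci2 [tuple y; x; x]].

Definition terminator_terms (Sg : signature) (A : algebra Sg)
    (c c1 c2 c11 c12 c21 c22 : term Sg 'I_3) : Prop :=
  [/\ forall x y : A,
        tval c [tuple x; y; x] = tval c1 [tuple x; x; y] /\
        tval c [tuple y; x; x] = tval c2 [tuple x; x; y],
      terminator_branch A c1 c11 c12
    & terminator_branch A c2 c21 c22].

Definition has_terminator_terms (Sg : signature) (A : algebra Sg) : Prop :=
  exists c c1 c2 c11 c12 c21 c22 : term Sg 'I_3,
    terminator_terms A c c1 c2 c11 c12 c21 c22.

Definition has_strong_terminator_terms (Sg : signature) (A : algebra Sg)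
    : Prop :=
  exists c c1 c2 c11 c12 c21 c22 : term Sg 'I_3,
    terminator_terms A c c1 c2 c11 c12 c21 c22 /\
    forall x y : A,
      tval c11 [tuple y; x; x] = tval c22 [tuple x; y; x].

(* Main.v *)
Require Import Defs.
From mathcomp Require Import all_boot.
From mathcomp Require Import boolp classical_sets filter.
From Stdlib Require List.

(* A Taylor algebra has an idempotent term [t] that satisfies, for each of its
   coordinates [i], an identity in two variables whose sides differ at [i]: if
   every term had a coordinate respected by all its identities, then applying
   this to iterated star products of the operations and using compactness would
   satisfy the given condition by projections.

   Double loop.  Let [F] be the free algebra on [x, y], and let [R] be the
   subalgebra of [F^4] generated by the tuples over [{x, y}] with [a <> b] or
   [c <> d].  The pairs [(c, d)] with [(p, p, c, d)] in [R] for some [p] form a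
   symmetric relation that [t] absorbs: one coordinate may be arbitrary.  Such a
   relation always has a loop.  Indeed, absorption yields closed walks of every
   large odd length; if there is no loop, then relations definable by short
   walks contain larger and larger cliques, and a clique [c] with one vertex for
   each coordinate of [t] makes [t(c)] adjacent to all of its vertices, hence to
   [t(t(c), ..., t(c)) = t(c)].  Composing [p] and [q] with each other improves
   [(p, p, q, q)] to a strong double loop.

   Weak 3-cube.  Let [C] be the subalgebra of [F^3] generated by the nonconstant
   triples.  Composing a strong double loop term with itself gives four
   identities [T(a_s) = T(b_s)] with the same value such that no coordinate
   occurs equally on both sides of two of them; playing them against each other
   yields an element [w] with [(w, w, w)] in [C].

   The remaining conditions follow by identification of variables. *)

Set Implicit Arguments.
Unset Strict Implicit.
Unset Printing Implicit Defensive.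

(** * Terms and Taylor identities *)

Section TermInduction.

Variables (Sg : signature) (V : Type) (P : term Sg V -> Prop).
Hypothesis PVar : forall v, P (Var Sg v).
Hypothesis PApp : forall f (ts : {ffun 'I_(arity f) -> term Sg V}),
  (forall i, P (ts i)) -> P (App ts).

Fixpoint term_nested_ind (t : term Sg V) : P t :=
  match t with
  | Var v => PVar v
  | App f ts => PApp (fun i => term_nested_ind (ts i))
  end.

End TermInduction.

Section Evaluation.

Variables (Sg : signature) (A : algebra Sg).

Lemma eval_ext (V : Type) (e e' : V -> A) (t : term Sg V) :
  e =1 e' -> eval e t = eval e' t.
Proof. by move=> /funext ->. Qed.

Lemma eval_subst (V W : Type) (s : V -> term Sg W) (e : W -> A) t :
  eval e (subst s t) = eval (fun v => eval e (s v)) t.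
Proof.
elim/term_nested_ind: t => //= f ts IH.
by congr op; apply/ffunP => i; rewrite !ffunE.
Qed.

Lemma eval_const (hA : idempotent_algebra A) (V : Type) (a : A) t :
  eval (fun _ : V => a) t = a.
Proof.
elim/term_nested_ind: t => //= f ts IH; rewrite -[RHS](hA f).
by congr op; apply/ffunP => i; rewrite !ffunE.
Qed.

Definition star (V W : Type) (t : term Sg V) (s : term Sg W)
    : term Sg (V * W) :=
  subst (fun v => subst (fun w => Var Sg (v, w)) s) t.

Lemma eval_star (V W : Type) (t : term Sg V) (s : term Sg W) e :
  eval e (star t s) = eval (fun v => eval (fun w => e (v, w)) s) t :> A.
Proof. by rewrite eval_subst; apply: eval_ext => v; rewrite eval_subst. Qed.

Definition two_valued (V : Type) (a : V -> bool) (x y : A) : V -> A :=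
  fun v => if a v then x else y.

Definition identity (V : Type) (t : term Sg V) (a b : V -> bool) : Prop :=
  forall x y : A, eval (two_valued a x y) t = eval (two_valued b x y) t.

Definition has_taylor_term : Prop :=
  exists (X : finType) (t : term Sg X),
    forall i, exists a b, identity t a b /\ a i != b i.

End Evaluation.

(** * Interpretation by projections and compactness *)

Section Projections.

Variables (Dl : signature).

Definition choice_of_args := forall f : Dl, 'I_(arity f).

Fixpoint projected (s : choice_of_args) (V : Type) (t : term Dl V) : V :=
  match t with
  | Var v => v
  | App f ts => projected s (ts (s f))
  end.

Lemma translate_projection (Sg : signature) (s : choice_of_args) V
    (t : term Dl V) :
  translate (fun f => Var Sg (s f)) t = Var Sg (projected s t).
Proof. by elim/term_nested_ind: t => //= f ts IH; rewrite IH. Qed.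

Fixpoint symbols_in (fs : seq Dl) (V : Type) (t : term Dl V) : Prop :=
  match t with
  | Var _ => True
  | App f ts => List.In f fs /\ forall i, symbols_in fs (ts i)
  end.

Fixpoint depth_le (d : nat) (V : Type) (t : term Dl V) : Prop :=
  match t with
  | Var _ => True
  | App f ts => if d is d'.+1 then forall i, depth_le d' (ts i) else False
  end.

Lemma symbols_in_sub fs fs' V (t : term Dl V) :
  (forall f, List.In f fs -> List.In f fs') ->
  symbols_in fs t -> symbols_in fs' t.
Proof.
move=> sub; elim/term_nested_ind: t => //= f ts IH [/sub ? H].
by split=> // i; apply: IH.
Qed.

Lemma depth_le_leq d d' V (t : term Dl V) :
  d <= d' -> depth_le d t -> depth_le d' t.
Proof.
elim/term_nested_ind: t d d' => [v [|?] [|?] //|f ts IH] [|d] [|d'] //= dd' H i.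
exact: IH (H i).
Qed.

Lemma In_flatten (T : Type) (I : eqType) (F : I -> seq T) (r : seq I) i x :
  i \in r -> List.In x (F i) -> List.In x (flatten [seq F j | j <- r]).
Proof.
elim: r => // j r IH; rewrite inE => /orP[/eqP<-|ir] xi /=.
  by apply: List.in_or_app; left.
by apply: List.in_or_app; right; apply: IH.
Qed.

Lemma symbols_in_exists V (t : term Dl V) : exists fs, symbols_in fs t.
Proof.
elim/term_nested_ind: t => [v|f ts /fin_all_exists[F HF]]; first by exists nil.
exists (f :: flatten [seq F i | i <- enum 'I_(arity f)]) => /=.
split=> [|i]; [by left|apply: symbols_in_sub (HF i) => g gi; right].
exact: In_flatten (mem_enum _ i) gi.
Qed.

Lemma depth_le_exists V (t : term Dl V) : exists d, depth_le d t.
Proof.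
elim/term_nested_ind: t => [v|f ts /fin_all_exists[d Hd]]; first by exists 0.
exists (\max_i d i).+1 => /= i; apply: depth_le_leq (Hd i).
exact: leq_bigmax.
Qed.

Lemma projected_ext (s s' : choice_of_args) fs V (t : term Dl V) :
  symbols_in fs t -> (forall f, List.In f fs -> s f = s' f) ->
  projected s t = projected s' t.
Proof.
move=> tfs ss'; elim/term_nested_ind: t tfs => //= f ts IH [ffs tsfs].
by rewrite ss' //; apply: IH.
Qed.

End Projections.

(* The solution is the limit of an ultrafilter on the set of all choices. *)
Lemma choice_compact (Dl : signature) (S : condition Dl) :
  (forall fs d, exists s : choice_of_args Dl, forall t u,
     S t u -> symbols_in fs t -> symbols_in fs u -> depth_le d t ->
     depth_le d u -> projected s t = projected s u) ->
  exists s : choice_of_args Dl, forall t u, S t u ->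
    projected s t = projected s u.
Proof.
move=> fin; pose B (p : seq Dl * nat) : set (choice_of_args Dl) :=
  fun s => forall t u, S t u -> symbols_in p.1 t -> symbols_in p.1 u ->
    depth_le p.2 t -> depth_le p.2 u -> projected s t = projected s u.
have BF : ProperFilter (filter_from setT B).
  apply: filter_from_proper; last first.
    by move=> [fs d] _; have [s sP] := fin fs d; exists s.
  apply: filter_fromT_filter; first by exists (nil, 0).
  move=> [fs d] [fs' d']; exists (fs ++ fs', maxn d d') => s sP.
  split=> t u tu /= tfs ufs td ud; apply: sP => //=.
  - by apply: symbols_in_sub tfs => f ?; apply: List.in_or_app; left.
  - by apply: symbols_in_sub ufs => f ?; apply: List.in_or_app; left.
  - exact: depth_le_leq (leq_maxl _ _) td.
  - exact: depth_le_leq (leq_maxl _ _) ud.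
  - by apply: symbols_in_sub tfs => f ?; apply: List.in_or_app; right.
  - by apply: symbols_in_sub ufs => f ?; apply: List.in_or_app; right.
  - exact: depth_le_leq (leq_maxr _ _) td.
  - exact: depth_le_leq (leq_maxr _ _) ud.
have [G [GU BG]] := ultraFilterLemma BF.
have Gf (f : Dl) : exists i : 'I_(arity f), G [set s | s f = i]%classic.
  apply: contrapT => /forallNP Nf.
  suff /(_ (enum 'I_(arity f)))/filter_ex[s] : forall r : seq 'I_(arity f),
      G [set s | s f \notin r]%classic by rewrite /= mem_enum.
  elim=> [|i r IH]; first by apply: filterS filterT.
  have [/Nf //|Gi] := in_ultra_setVsetC [set s | s f = i]%classic GU.
  apply: filterS (filterI Gi IH) => s [si sr] /=.
  by rewrite inE negb_or sr andbT; apply/eqP.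
pose s f := projT1 (cid (Gf f)); exists s => t u tu.
have [fs tfs] := symbols_in_exists t; have [gs ugs] := symbols_in_exists u.
have [d td] := depth_le_exists t; have [e ue] := depth_le_exists u.
have sub1 f : List.In f fs -> List.In f (fs ++ gs).
  by move=> ?; apply: List.in_or_app; left.
have sub2 f : List.In f gs -> List.In f (fs ++ gs).
  by move=> ?; apply: List.in_or_app; right.
have agree : forall hs,
    G [set s' | forall f, List.In f hs -> s f = s' f]%classic.
  elim=> [|f hs IH]; first by apply: filterS filterT => ? _ ? [].
  apply: filterS (filterI (projT2 (cid (Gf f))) IH) => s' [s'f s'hs] g [<-|].
    by rewrite s'f.
  exact: s'hs.
have /BG GB : filter_from setT B (B (fs ++ gs, maxn d e)).
  by exists (fs ++ gs, maxn d e).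
have [s' [Bs' ss']] := filter_ex (filterI GB (agree (fs ++ gs))).
have tF := symbols_in_sub sub1 tfs; have uF := symbols_in_sub sub2 ugs.
rewrite (projected_ext tF ss') (projected_ext uF ss'); apply: Bs' => //=.
  exact: depth_le_leq (leq_maxl _ _) td.
exact: depth_le_leq (leq_maxr _ _) ue.
Qed.

Lemma count_pigeonhole (X : finType) (l : seq X) d :
  d * #|X| < size l -> exists x, d < count_mem x l.
Proof.
move=> dl; apply/existsP; apply: contraLR dl.
rewrite negb_exists -leqNgt => /forallP cnt.
have <- : \sum_x count_mem x l = size l.
  elim: l {cnt} => [|y l IH] /=; first by rewrite big1.
  rewrite big_split IH (bigD1 y) //= eqxx big1 // => x /negPf.
  by rewrite eq_sym => ->.
rewrite mulnC -sum_nat_const; apply: leq_sum => x _.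
by rewrite leqNgt; apply: cnt.
Qed.

(** * Taylor terms from star powers *)

Section TaylorTerm.

Variables (Sg : signature) (A : algebra Sg).
Hypothesis hA : idempotent_algebra A.

Definition respects_coordinate (X : finType) (t : term Sg X) (i : X) : Prop :=
  forall a b, identity A t a b -> a i = b i.

Section Interpretation.

Variables (Dl : signature) (I : interpretation Dl Sg).

Definition evalI (V : Type) (e : V -> A) (t : term Dl V) : A :=
  eval e (translate I t).

Lemma evalI_App (V : Type) (e : V -> A) f
    (ts : {ffun 'I_(arity f) -> term Dl V}) :
  evalI e (App ts) = eval (fun i => evalI e (ts i)) (I f).
Proof. exact: eval_subst. Qed.

(** An iterated star product works: when the variables depend on one factor only, idempotence
    collapses the others. *)
Lemma common_term (fs : seq Dl) :
  exists (X : finType) (T : term Sg X), forall f, List.In f fs ->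
    exists pi : X -> 'I_(arity f), forall e : 'I_(arity f) -> A,
      eval (fun x => e (pi x)) T = eval e (I f).
Proof.
elim: fs => [|f fs [X [T HT]]]; first by exists unit, (Var Sg tt).
exists ('I_(arity f) * X)%type, (star (I f) T) => g [<-|/HT[pi Hpi]].
  exists fst => e; rewrite eval_star /=.
  by apply: eval_ext => i; rewrite eval_const.
by exists (fun x => pi x.2) => e; rewrite eval_star /= Hpi eval_const.
Qed.

Variables (X : finType) (T : term Sg X) (pi : forall f : Dl, X -> 'I_(arity f)).

Fixpoint tpower (D : nat) : term Sg (D.-tuple X) :=
  if D is D'.+1 then
    subst (fun x => subst (fun l : D'.-tuple X => Var Sg [tuple of x :: l])
                          (tpower D')) T
  else Var Sg [tuple].

Lemma eval_tpowerS D (e : D.+1.-tuple X -> A) :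
  eval e (tpower D.+1)
    = eval (fun x => eval (fun l : D.-tuple X => e [tuple of x :: l])
                          (tpower D)) T.
Proof. by rewrite eval_subst; apply: eval_ext => x; rewrite eval_subst. Qed.

Definition argument (x : X) (V : Type) (t : term Dl V) : term Dl V :=
  match t with Var v => Var Dl v | App f ts => ts (pi f x) end.

(* The subterm reached from [t] by descending along the letters of [l] whose
   level is marked in [m]. *)
Fixpoint descend (m : seq bool) (l : seq X) (V : Type) (t : term Dl V)
    : term Dl V :=
  match m, l with
  | b :: m', x :: l' => descend m' l' (if b then argument x t else t)
  | _, _ => t
  end.

(** Unmarked levels of the power collapse by idempotence. At a marked level [T] acts through [pi] as
    the root symbol of [t], or collapses if [t] is a variable. *)
Lemma eval_descend fs D m (V : Type) (e : V -> A) (t : term Dl V) :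
  (forall f, List.In f fs -> forall e : 'I_(arity f) -> A,
     eval (fun x => e (pi f x)) T = eval e (I f)) ->
  symbols_in fs t ->
  eval (fun l : D.-tuple X => evalI e (descend m l t)) (tpower D) = evalI e t.
Proof.
move=> piP; elim: D m t => [|D IH] [|b m] t tfs.
- by rewrite eval_const.
- by [].
- by rewrite eval_const.
rewrite eval_tpowerS /=.
have arg x : symbols_in fs (if b then argument x t else t).
  by case: b => //; case: t tfs => //= f ts [_ tsfs].
transitivity (eval (fun x => evalI e (if b then argument x t else t)) T).
  by apply: eval_ext => x; apply: IH.
case: b {arg} => //; last by rewrite eval_const.
case: t tfs => [v _|f ts [ffs _]] /=; first by rewrite eval_const.
by rewrite evalI_App -piP.
Qed.

Lemma descend_depth d m l (V : Type) (t : term Dl V) :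
  depth_le d t -> d <= count id m -> size l = size m ->
  exists v, descend m l t = Var Dl v.
Proof.
elim: m l d t => [|b m IH] l d t.
  case: l => //= td; rewrite leqn0 => /eqP d0 _.
  by case: t td => [v|f ts]; [exists v|rewrite d0].
case: l => // x l td dm [lm] /=; case: b dm => /= dm; last exact: (IH l d).
case: t td => [v|f ts]; first by move=> _; apply: (IH l 0).
by case: d dm => // d dm /= /(_ (pi f x)) td; apply: (IH l d).
Qed.

Lemma projected_descend x l (V : Type) (t : term Dl V) :
  projected (fun f => pi f x) (descend [seq y == x | y <- l] l t)
    = projected (fun f => pi f x) t.
Proof.
by elim: l t => [|y l IH] t //=; rewrite IH; case: eqP => // ->; case: t.
Qed.

End Interpretation.

(** A respected coordinate [l] of a long star power contains some letter [x] more than [d] times.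
    Descending at the positions of [x] turns equations of [S] into identities of the power, and
    respecting [l] makes the projections given by [x] agree. *)
Lemma finitely_trivial (Dl : signature) (I : interpretation Dl Sg)
    (S : condition Dl) (fs : seq Dl) (d : nat) :
  (forall (X : finType) (t : term Sg X), exists i, respects_coordinate t i) ->
  (forall s t, S s t -> satisfies A (translate I s) (translate I t)) ->
  exists s : choice_of_args Dl, forall t u, S t u ->
    symbols_in fs t -> symbols_in fs u -> depth_le d t -> depth_le d u ->
    projected s t = projected s u.
Proof.
move=> resp IS; have [X [T TP]] := common_term I fs.
have piE f : exists pi : X -> 'I_(arity f),
    List.In f fs -> forall e : 'I_(arity f) -> A,
      eval (fun x => e (pi x)) T = eval e (I f).
  (* A respected coordinate of [I f] serves as the default argument position for [f] outside
     [fs]. *)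
  have [i _] := resp _ (I f).
  case: (EM (List.In f fs)) => [/TP[pi Hpi]|Nf]; first by exists pi.
  by exists (fun _ => i).
pose pi f := projT1 (cid (piE f)); have piP f := projT2 (cid (piE f)).
have [l lP] := resp _ (tpower T (d * #|X|).+1).
have [|x xl] := @count_pigeonhole X l d; first by rewrite size_tuple.
exists (fun f => pi f x) => t u tu tfs ufs td ud.
pose m := [seq y == x | y <- l].
(* By [mP], the default [0] is never reached from terms of depth at most [d]. *)
pose var (v : term Dl nat) : nat := if v is Var k then k else 0.
have mP (k : (d * #|X|).+1.-tuple X) v : depth_le d v ->
    descend pi m k v = Var Dl (var (descend pi m k v)).
  move=> vd; suff [w ->] : exists w, descend pi m k v = Var Dl w by [].
  apply: descend_depth vd _ _; last by rewrite size_map !size_tuple.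
  by rewrite count_map; apply: ltnW.
have lt v : depth_le d v ->
    var (descend pi m l v) = projected (fun f => pi f x) v.
  by move=> /(mP l) vd; rewrite -(projected_descend pi x l) -/m vd.
rewrite -!lt //; set k := var _.
(* With [k] sent to [y] and all other variables to [z], the equation becomes an identity of the
   power. At coordinate [l] it says that [u] also descends to [k]. *)
have := lP (fun k' => var (descend pi m k' t) == k)
           (fun k' => var (descend pi m k' u) == k).
rewrite eqxx => H; apply/esym/eqP/esym/H => y z.
have E v : depth_le d v -> symbols_in fs v ->
    eval (two_valued (fun k' : (d * #|X|).+1.-tuple X =>
       var (descend pi m k' v) == k) y z) (tpower T (d * #|X|).+1) =
    evalI I (fun j => if j == k then y else z) v.
  move=> vd vfs; rewrite -(eval_descend (d * #|X|).+1 m _ piP vfs).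
  by apply: eval_ext => k'; rewrite [in RHS]mP.
by rewrite !E //; apply: IS tu _.
Qed.

Lemma taylor_has_taylor_term : taylor A -> has_taylor_term A.
Proof.
move=> [Dl [S [_ Snt [I IS]]]]; apply: contrapT => NT; apply: Snt => Sg' A'.
have resp (X : finType) (t : term Sg X) : exists i, respects_coordinate t i.
  apply: contrapT => Ni; apply: NT; exists X, t => i.
  apply: contrapT => Nab; apply: Ni; exists i => a b ab.
  by apply/eqP/negPn/negP => ?; apply: Nab; exists a, b.
have [fs d|s sP] := choice_compact (S := S).
  exact: finitely_trivial resp IS.
exists (fun f => Var Sg' (s f)) => t u tu e.
by rewrite !translate_projection /= (sP t u tu).
Qed.

End TaylorTerm.

(** * Absorbed symmetric relations have loops *)

(* [o] contains at most one coordinate, and there the pair is arbitrary. *)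
Definition absorbing (X : finType) (F : Type) (tt : (X -> F) -> F)
    (P : F -> F -> Prop) : Prop :=
  forall (o : pred X) (u v : X -> F),
    (forall i j, o i -> o j -> i = j) ->
    (forall i, ~~ o i -> P (u i) (v i)) -> P (tt u) (tt v).

(** The pair [x], [y] is kept apart from the hubs [h] because walks move along it while the hubs
    stay fixed. *)
Definition clique (F : Type) (P : F -> F -> Prop) (k : nat) (x y : F)
    (h : nat -> F) : Prop :=
  [/\ P x y, forall i, i < k -> P x (h i), forall i, i < k -> P y (h i)
    & forall i j, i < k -> j < k -> i <> j -> P (h i) (h j)].

(* A loop [hub_walk P k x x] amounts to a clique with [k + 3] vertices. *)
Definition hub_walk (F : Type) (P : F -> F -> Prop) (k : nat) (x y : F)
    : Prop :=
  exists (p q : F) (h : nat -> F),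
    [/\ clique P k x p h, P p q, forall i, i < k -> P q (h i), P q y
      & forall i, i < k -> P y (h i)].

Definition upd (F : Type) (h : nat -> F) (k : nat) (x : F) : nat -> F :=
  fun i => if i == k then x else h i.

Section AbsorbedLoop.

Variables (X : finType) (F : Type) (tt : (X -> F) -> F).
Hypothesis tt_idem : forall a, tt (fun _ => a) = a.

Implicit Types P : F -> F -> Prop.

Lemma absorbingT P u v :
  absorbing tt P -> (forall i, P (u i) (v i)) -> P (tt u) (tt v).
Proof. by move=> Pabs Puv; apply: (Pabs pred0). Qed.

Section Symmetric.

Variable P : F -> F -> Prop.
Hypothesis Psym : forall x y, P x y -> P y x.

Lemma clique_swap k x y h : clique P k x y h -> clique P k y x h.
Proof. by case=> xy xh yh hh; split=> //; apply: Psym. Qed.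

Lemma clique_rot k x y h i : i < k ->
  clique P k x y h -> clique P k x (h i) (upd h i y).
Proof.
move=> ik [xy xh yh hh]; split=> [|j jk|j jk|j l jk lk jl].
- exact: xh.
- by rewrite /upd; case: eqP => // _; apply: xh.
- rewrite /upd; case: eqP => [_|ji]; first by apply/Psym/yh.
  by apply: hh => // ij; apply: ji.
- rewrite /upd; case: eqP => [ji|_]; case: eqP => [li|_].
  + by case: jl; rewrite ji.
  + exact: yh.
  + exact/Psym/yh.
  + exact: hh.
Qed.

Lemma clique_hub_walk k x y h : clique P k x y h -> hub_walk P k x y.
Proof.
move=> xyh; case: (xyh) => xy xh yh hh.
by exists y, x, h; split=> //; apply: Psym.
Qed.

Lemma hub_walk_sym k x y : hub_walk P k x y -> hub_walk P k y x.
Proof.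
move=> [p [q [h [[xp xh ph hh] pq qh qy yh]]]].
by exists q, p, h; split=> //; [split=> //|..]; apply: Psym.
Qed.

(** Three steps of a walk become one step for [hub_walk P k]. The fourth step joins [y] to the hubs,
    and rotating the first clique joins the hubs to each other. *)
Lemma clique_hub_walk_step k x p q y z h :
  clique P k x p h -> clique P k p q h -> clique P k q y h ->
  clique P k y z h -> clique (hub_walk P k) k x y h.
Proof.
move=> xph pqh qyh yzh.
have edge w w' i : i < k -> clique P k w w' h -> hub_walk P k w (h i).
  by move=> ik ww'h; apply: (clique_hub_walk (clique_rot ik ww'h)).
split=> [|i ik|i ik|i j ik jk ij].
- case: pqh => pq _ qh _; case: qyh => qy _ yh _.
  by exists p, q, h; split.
- exact: edge xph.
- exact: edge yzh.
- have jh : upd h i p j = h j.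
    by rewrite /upd; case: (altP (j =P i)) => // ji; case: ij.
  rewrite -jh; apply: clique_hub_walk (clique_rot jk _).
  exact: clique_swap (clique_rot ik xph).
Qed.

Lemma hub_walk_loop k x : hub_walk P k x x ->
  exists p h, clique P k.+1 x p h.
Proof.
move=> [p [q [h [[xp xh ph hh] pq qh qx _]]]].
exists p, (upd h k q); split=> // [i|i|i j]; rewrite ltnS leq_eqVlt.
- by rewrite /upd; case: eqP => [_ _|_ /= /xh //]; apply: Psym.
- by rewrite /upd; case: eqP => [_ _|_ /= /ph //].
- rewrite ltnS (leq_eqVlt j) /upd.
  case: eqP => [->|_] /= ik; case: eqP => [->|_] //= jk ij.
  + exact: qh.
  + exact/Psym/qh.
  + exact: hh.
Qed.

(** Witnesses are combined coordinatewise by [tt]; at the exceptional coordinate they are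
    arbitrary. *)
Lemma hub_walk_absorbing k :
  absorbing tt P -> absorbing tt (hub_walk P k).
Proof.
move=> Pabs o u v o1 uv.
have /fin_all_exists[w wP] i : exists w : F * F * (nat -> F), ~~ o i ->
    [/\ clique P k (u i) w.1.1 w.2, P w.1.1 w.1.2,
        forall l, l < k -> P w.1.2 (w.2 l), P w.1.2 (v i)
      & forall l, l < k -> P (v i) (w.2 l)].
  case: (boolP (o i)) => [_|/uv[p [q [h H]]]].
    by exists (u i, u i, fun _ => u i).
  by exists (p, q, h).
exists (tt (fun i => (w i).1.1)), (tt (fun i => (w i).1.2)),
  (fun l => tt (fun i => (w i).2 l)).
split=> [|||| l lk]; [split=> [|l lk|l lk|l m lk mk lm] | |move=> l lk | |];
  apply: (Pabs o) => // i /wP [[? xh ph hh] ? qh ? yh];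
  by [|apply: xh|apply: ph|apply: hh|apply: qh|apply: yh].
Qed.

(* Coordinate number [r] of the walk alternates between [x] and [y], except
   that it pauses at step [r]; there [absorbing] allows an arbitrary pair. *)
Lemma closed_walk k x y h L :
  absorbing tt P -> clique P k x y h -> odd L -> #|X| <= L ->
  exists w, w L = w 0 /\ forall s, clique P k (w s) (w s.+1) h.
Proof.
move=> Pabs [xy xh yh hh] Lodd XL.
exists (fun s =>
  tt (fun i : X => if odd s (+) (enum_rank i < s) then y else x)); split.
  congr tt; apply: funext => i; rewrite Lodd.
  by rewrite (leq_trans (ltn_ord (enum_rank i)) XL).
move=> s; split=> // [|i ik|i ik].
- apply: (Pabs [pred i | enum_rank i == s :> nat]) => [i j|i] /=.
    by move=> /eqP <- /eqP /ord_inj /enum_rank_inj.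
  move=> /negPf ris; rewrite ltnS (leq_eqVlt (enum_rank i) s) ris /= addNb.
  by case: (_ (+) _) => //=; apply: Psym.
- rewrite -[h i]tt_idem; apply: absorbingT => // j.
  by case: ifP => _; [apply: yh|apply: xh].
- rewrite -[h i]tt_idem; apply: absorbingT => // j.
  by case: ifP => _; [apply: yh|apply: xh].
Qed.

Lemma clique_loop x y h :
  absorbing tt P -> clique P #|X| x y h -> exists z, P z z.
Proof.
move=> Pabs [_ _ _ hh]; pose c (i : X) := h (enum_rank i); exists (tt c).
have cw i : P (c i) (tt c).
  rewrite -[c i]tt_idem; apply: (Pabs (pred1 i)) => [j l /eqP-> /eqP-> //|j].
  by move=> ji; apply: hh => //= /ord_inj /enum_rank_inj ij; case/eqP: ji.
by rewrite -[X in P _ X]tt_idem; apply: absorbingT.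
Qed.

End Symmetric.

(* Without a loop, passing to [hub_walk] as long as it has no loop triples the
   length of the steps of a closed walk of length [3 ^ #|X|], so a loop of some
   [hub_walk] must show up and yields a larger clique. *)
Lemma clique_grow P k x y h :
  (forall x y, P x y -> P y x) -> absorbing tt P -> (forall z, ~ P z z) ->
  clique P k x y h ->
  exists P', [/\ forall x y, P' x y -> P' y x, absorbing tt P',
    forall z, ~ P' z z & exists x y h, clique P' k.+1 x y h].
Proof.
move=> Psym Pabs Ploop xyh; apply: contrapT => nogrow.
have [||w [w0 wP]] := closed_walk Psym Pabs xyh (L := 3 ^ #|X|).
- by rewrite oddX orbT.
- exact/ltnW/ltn_expl.
pose Pn n := iter n (fun P => hub_walk P k) P.
suff /(_ #|X|)[_ _ Nloop] : forall n,
    [/\ forall x y, Pn n x y -> Pn n y x, absorbing tt (Pn n),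
        forall z, ~ Pn n z z
      & forall s, clique (Pn n) k (w s) (w (s + 3 ^ n)) h].
  by move=> /(_ 0)[]; rewrite add0n w0 => /Nloop.
elim=> [|n [nsym nabs nloop nw]].
  by split=> // s; rewrite addn1.
split=> /= [z t|| z /hub_walk_loop|s].
- exact: hub_walk_sym.
- exact: hub_walk_absorbing.
- move=> /(_ nsym)[p [h' ph']]; apply: nogrow.
  by exists (Pn n); split=> //; exists z, p, h'.
- have e3 : s + 3 ^ n.+1 = s + 3 ^ n + 3 ^ n + 3 ^ n.
    by rewrite expnS !mulSn mul0n addn0 !addnA.
  by rewrite e3; apply: clique_hub_walk_step.
Qed.

Lemma absorbing_loop P x y :
  (forall x y, P x y -> P y x) -> absorbing tt P -> P x y ->
  exists z, P z z.
Proof.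
move=> Psym Pabs xy; apply: contrapT => Nloop.
suff /(_ #|X|)[P' [P'sym P'abs P'loop [z [t [h zth]]]]] : forall k,
    exists P', [/\ forall x y, P' x y -> P' y x, absorbing tt P',
      forall z, ~ P' z z & exists x y h, clique P' k x y h].
  by have [? /P'loop] := clique_loop P'abs zth.
elim=> [|k [P' [P'sym P'abs P'loop [z [t [h zth]]]]]].
  exists P; split=> // [z zz|]; first by apply: Nloop; exists z.
  by exists x, y, (fun _ => x); split.
exact: clique_grow zth.
Qed.

End AbsorbedLoop.

(** * Double loops in the free algebra *)

Section BinaryTermFunctions.

Variables (Sg : signature) (A : algebra Sg).
Hypothesis hA : idempotent_algebra A.

Definition is_binary (f : A -> A -> A) : Prop :=
  exists E : term Sg bool, forall x y,
    f x y = eval (fun b : bool => if b then x else y) E.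

(* The free algebra on two generators, as an algebra of binary functions. *)
Definition bfun : Type := {f : A -> A -> A | is_binary f}.

Lemma bfunP (f g : bfun) : (forall x y, sval f x y = sval g x y) -> f = g.
Proof.
by case: f g => [f Hf] [g Hg] /= fg; apply: eq_exist; do 2!apply: funext => ?.
Qed.

Lemma proj_is_binary (b : bool) : is_binary (fun x y => if b then x else y).
Proof. by exists (Var Sg b). Qed.

Definition proj (b : bool) : bfun := exist _ _ (proj_is_binary b).

Lemma swap_is_binary (f : bfun) : is_binary (fun x y => sval f y x).
Proof.
have [E fE] := svalP f; exists (subst (fun b => Var Sg (~~ b)) E) => x y.
by rewrite fE eval_subst; apply: eval_ext => -[].
Qed.

Definition swap (f : bfun) : bfun := exist _ _ (swap_is_binary f).

Definition pw (f : bfun) (b : bool) : bfun := if b then f else swap f.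

Lemma app_is_binary (X : finType) (T : term Sg X) (u : X -> bfun) :
  is_binary (fun x y => eval (fun i => sval (u i) x y) T).
Proof.
have /fin_all_exists[E uE] i := svalP (u i).
exists (subst E T) => x y; rewrite eval_subst; apply: eval_ext => i.
exact: uE.
Qed.

Definition app (X : finType) (T : term Sg X) (u : X -> bfun) : bfun :=
  exist _ _ (app_is_binary T u).

Lemma comp_is_binary (f e : bfun) :
  is_binary (fun x y => sval f (sval e x y) (sval e y x)).
Proof.
have [E fE] := svalP f; have [E' eE] := svalP (app E (pw e)).
by exists E' => x y; rewrite -eE fE; apply: eval_ext => -[].
Qed.

(* The image of [f] under the endomorphism of the free algebra that sends the
   generators to [e] and [swap e]. *)
Definition comp (f e : bfun) : bfun := exist _ _ (comp_is_binary f e).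

Lemma app_const (X : finType) (T : term Sg X) f : app T (fun _ => f) = f.
Proof. by apply: bfunP => x y /=; rewrite eval_const. Qed.

Lemma app_ext (X : finType) (T : term Sg X) u v : u =1 v -> app T u = app T v.
Proof. by move=> /funext ->. Qed.

Lemma swapK f : swap (swap f) = f.
Proof. exact: bfunP. Qed.

Lemma swap_pw f b : swap (pw f b) = pw f (~~ b).
Proof. by case: b => //=; rewrite swapK. Qed.

Lemma pw_swap f b : pw (swap f) b = pw f (~~ b).
Proof. by case: b => //=; rewrite swapK. Qed.

Lemma swap_proj b : swap (proj b) = proj (~~ b).
Proof. by case: b; apply: bfunP. Qed.

Lemma pw_proj b c : pw (proj b) c = proj (b == c).
Proof. by case: b c => -[]; apply: bfunP. Qed.

Lemma swap_app (X : finType) (T : term Sg X) u :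
  swap (app T u) = app T (fun i => swap (u i)).
Proof. exact: bfunP. Qed.

Lemma comp_app (X : finType) (T : term Sg X) u e :
  comp (app T u) e = app T (fun i => comp (u i) e).
Proof. exact: bfunP. Qed.

Lemma comp_proj b e : comp (proj b) e = pw e b.
Proof. by case: b; apply: bfunP. Qed.

Lemma comp_pw f b e : comp (pw f b) e = pw (comp f e) b.
Proof. by case: b; apply: bfunP. Qed.

Lemma bfun_term f : exists E : term Sg bool,
  f = app E proj /\ forall e, comp f e = app E (pw e).
Proof.
have [E fE] := svalP f; exists E; split=> [|e]; apply: bfunP => x y /=.
  by rewrite fE; apply: eval_ext => -[].
by rewrite fE; apply: eval_ext => -[].
Qed.

(* The subalgebra of the fourth power that is generated by the columns of the
   double loop identities. *)
Inductive dbl : bfun -> bfun -> bfun -> bfun -> Prop :=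
| dbl_proj a b c d : (a != b) || (c != d) ->
    dbl (proj a) (proj b) (proj c) (proj d)
| dbl_app (X : finType) (T : term Sg X) u1 u2 u3 u4 :
    (forall i, dbl (u1 i) (u2 i) (u3 i) (u4 i)) ->
    dbl (app T u1) (app T u2) (app T u3) (app T u4).

Lemma dbl_blocks f g h k : dbl f g h k -> dbl h k f g.
Proof.
elim=> [a b c d abcd|X T u1 u2 u3 u4 _ IH]; last exact: dbl_app.
by apply: dbl_proj; rewrite orbC.
Qed.

Lemma dbl_flip f g h k : dbl f g h k -> dbl f g k h.
Proof.
elim=> [a b c d abcd|X T u1 u2 u3 u4 _ IH]; last exact: dbl_app.
by apply: dbl_proj; rewrite (eq_sym d).
Qed.

(** Idempotence lets the entries be expanded into generators one after another while the others stay
    constant; the first two are expanded together and stay opposite. *)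
Lemma dbl_swapl f g h : dbl f (swap f) g h.
Proof.
have [E [-> _]] := bfun_term f; have [E' [-> _]] := bfun_term g.
have [E'' [-> _]] := bfun_term h; rewrite swap_app.
rewrite -[X in dbl _ _ X _](app_const E) -[X in dbl _ _ _ X](app_const E).
apply: dbl_app => a.
rewrite -[X in dbl X _ _ _](app_const E') -[X in dbl _ X _ _](app_const E').
rewrite -[X in dbl _ _ _ X](app_const E'); apply: dbl_app => b.
rewrite -[X in dbl X _ _ _](app_const E'') -[X in dbl _ X _ _](app_const E'').
rewrite -[X in dbl _ _ X _](app_const E''); apply: dbl_app => c.
by rewrite swap_proj; apply: dbl_proj; case: a.
Qed.

Lemma dbl_swapr f g h : dbl f g h (swap h).
Proof. exact/dbl_blocks/dbl_swapl. Qed.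

Lemma dbl_pw_neq f g h a b : a != b -> dbl (pw f a) (pw f b) g h.
Proof.
move=> ab; have -> : pw f b = swap (pw f a).
  by rewrite swap_pw; case: a b ab => -[].
exact: dbl_swapl.
Qed.

(** Where the first two generators agree, the last two are opposite and the front pair is arbitrary;
    where they differ, their images are opposite. *)
Lemma dbl_comp f g h k e : dbl f g h k -> dbl (comp f e) (comp g e) h k.
Proof.
elim=> [a b c d|X T u1 u2 u3 u4 _ IH]; last first.
  by rewrite !comp_app; apply: dbl_app.
rewrite !comp_proj; have [-> /= cd|ab _] := eqVneq a b; last exact: dbl_pw_neq.
have -> : proj d = swap (proj c) by rewrite swap_proj; case: c d cd => -[].
exact: dbl_swapr.
Qed.

(* Equivalent to [dbl p p h k], but stable under replacing [p] by any element of
   the subalgebra generated by [p] and [swap p]. *)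
Definition free_for (p h k : bfun) : Prop :=
  forall a b, dbl (pw p a) (pw p b) h k.

Lemma dbl_free_for p h k : dbl p p h k -> free_for p h k.
Proof.
move=> pphk a b; have [->|] := eqVneq a b; last exact: dbl_pw_neq.
case: b => //=; rewrite -[swap p](_ : comp p (proj false) = _).
  exact: dbl_comp.
exact: bfunP.
Qed.

Lemma free_for_comp p e h k : free_for p h k -> free_for (comp p e) h k.
Proof. by move=> pf a b; rewrite -!comp_pw; apply: dbl_comp. Qed.

(** [comp e p] is a term in [p] and [swap p]. Its two occurrences are expanded separately, which
    requires every pair [a], [b] in [free_for]. *)
Lemma free_for_sub p e h k : free_for p h k -> free_for (comp e p) h k.
Proof.
have [E [_ eE]] := bfun_term e.
have pwE b : pw (comp e p) b = app E (fun c => pw p (b == c)).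
  rewrite eE; case: b => /=; first by apply: app_ext => -[].
  by rewrite swap_app; apply: app_ext => -[] //=; rewrite swapK.
move=> pf a b; rewrite [in X in dbl X]pwE.
rewrite -[pw _ b](app_const E) -[h](app_const E) -[k](app_const E).
apply: dbl_app => c; rewrite pwE -[pw p _](app_const E).
rewrite -[h](app_const E) -[k](app_const E).
exact: dbl_app.
Qed.

(** [comp e p] is both an endomorphic image of [e] and a term in [p] and [swap p], so it inherits
    freeness from both. *)
Lemma free_for_common (I : eqType) (r : seq I) (h k : I -> bfun) :
  (forall i, i \in r -> exists p, free_for p (h i) (k i)) ->
  exists e, forall i, i \in r -> free_for e (h i) (k i).
Proof.
elim: r => [|i r IH] hk; first by exists (proj true).
have [j jr|e He] := IH; first by apply: hk; rewrite inE jr orbT.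
have [|p Hp] := hk i; first by rewrite inE eqxx.
exists (comp e p) => j; rewrite inE => /orP[/eqP->|/He].
  exact: free_for_sub.
exact: free_for_comp.
Qed.

Lemma double_loop_free : has_taylor_term A -> exists p q, dbl p p q q.
Proof.
move=> [X [T TP]]; pose Q h k := exists p, free_for p h k.
suff [q [p /(_ true true)]] : exists q, Q q q by exists p, q.
apply: (absorbing_loop (app_const T) (P := Q) (x := proj true)
                       (y := proj false)).
- by move=> h k [p Hp]; exists p => a b; apply: dbl_flip.
- move=> o u v o1 uv.
  have [|e He] := @free_for_common _ [seq i <- enum X | ~~ o i] u v.
    by move=> i; rewrite mem_filter => /andP[/uv].
  (* The identity is chosen to differ at the coordinate in [o]; if [o] is empty, a trivial identity
     does. *)
  have [a [b [ab abo]]] : exists a b, identity A T a b /\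
      forall i, o i -> a i != b i.
    case: (pickP o) => [i oi|o0].
      have [a [b [ab abi]]] := TP i; exists a, b; split=> // j oj.
      by rewrite (o1 j i).
    by exists xpred0, xpred0; split=> // i; rewrite o0.
  (* Both sides of the identity, taken at [e] and [swap e], have this value. On [o] their entries
     are opposite, which leaves [u] and [v] unconstrained there; elsewhere [e] is free for them. *)
  exists (app T (fun i => pw e (a i))); apply: dbl_free_for.
  have {2}-> : app T (fun i => pw e (a i)) = app T (fun i => pw e (b i)).
    apply: bfunP => x y /=.
    have := ab (sval e x y) (sval e y x); congr (_ = _);
      by apply: eval_ext => i; rewrite /two_valued /pw; case: ifP.
  apply: dbl_app => i; case: (boolP (o i)) => [/abo|oi].
    exact: dbl_pw_neq.
  by apply: He; rewrite mem_filter oi mem_enum.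
- exists (proj true); apply: dbl_free_for; apply: dbl_proj.
  by rewrite orbT.
Qed.

(** As an endomorphic image of [p], [comp p q] may replace [p] in the first block; as a term in [q]
    and [swap q], it may then replace [q] in the second. *)
Lemma strong_double_loop_free p q :
  dbl p p q q -> exists r, dbl r r r r.
Proof.
move=> ppqq; exists (comp p q).
have := free_for_comp q (dbl_free_for ppqq).
move=> /(_ true true) /dbl_blocks /dbl_free_for /(free_for_sub p).
by move=> /(_ true true).
Qed.

End BinaryTermFunctions.

(** * The weak 3-cube *)

Section WeakCube.

Variables (Sg : signature) (A : algebra Sg).
Hypothesis hA : idempotent_algebra A.

Local Notation bfun := (bfun A).
Local Notation proj := (proj A).

(* The subalgebra of the third power that is generated by the columns of the
   weak 3-cube identities. *)
Inductive cube : bfun -> bfun -> bfun -> Prop :=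
| cube_proj a b c : ~~ ((a == b) && (b == c)) ->
    cube (proj a) (proj b) (proj c)
| cube_app (X : finType) (T : term Sg X) u1 u2 u3 :
    (forall i, cube (u1 i) (u2 i) (u3 i)) ->
    cube (app T u1) (app T u2) (app T u3).

Lemma cube_rot f g h : cube f g h -> cube g h f.
Proof.
elim=> [a b c abc|X T u1 u2 u3 _ IH]; last exact: cube_app.
by apply: cube_proj; case: a b c abc => -[] [].
Qed.

Lemma cube_swap f g h : cube f g h -> cube (swap f) (swap g) (swap h).
Proof.
elim=> [a b c abc|X T u1 u2 u3 _ IH]; last first.
  by rewrite !swap_app; apply: cube_app.
by rewrite !swap_proj; apply: cube_proj; case: a b c abc => -[] [].
Qed.

Lemma cube_app3 (X : finType) (T : term Sg X) f g h :
  (forall i, cube f g (h i)) -> cube f g (app T h).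
Proof.
move=> fgh; rewrite -[f](app_const hA T) -[g](app_const hA T).
exact: cube_app.
Qed.

Lemma cube_swapl f h : cube f (swap f) h.
Proof.
have [E [-> _]] := bfun_term f; have [E' [-> _]] := bfun_term h.
apply: cube_app3 => c; rewrite swap_app -[proj c](app_const hA E).
by apply: cube_app => a; rewrite swap_proj; apply: cube_proj; case: a.
Qed.

Lemma cube_pw_neq f h a b : a != b -> cube (pw f a) (pw f b) h.
Proof.
move=> ab; have -> : pw f b = swap (pw f a).
  by rewrite swap_pw; case: a b ab => -[].
exact: cube_swapl.
Qed.

(** * Four identities with a common value and pairwise disjoint equality sets *)

Section DisjointIdentities.

Variables (X : finType) (T : term Sg X) (rho : bfun -> bfun).
Variables al be : bool * bool -> X -> bool.
Hypothesis rho_al : forall s u, rho u = app T (fun l => pw u (al s l)).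
Hypothesis rho_be : forall s u, rho u = app T (fun l => pw u (be s l)).
Hypothesis disjoint : forall s s' l,
  al s l = be s l -> al s' l = be s' l -> s = s'.

Lemma rho_pw u c : pw (rho u) c = rho (pw u c).
Proof.
case: c => //=; rewrite !(rho_al (true, true)) swap_app.
by apply: app_ext => l; rewrite swap_pw pw_swap.
Qed.

(** The two sides of identity [s] fill the first two entries; where they differ they are opposite,
    so [h] is constrained only on the equality set. *)
Lemma cube_rho s u h :
  (forall l, al s l = be s l -> cube (pw u (al s l)) (pw u (al s l)) (h l)) ->
  cube (rho u) (rho u) (app T h).
Proof.
move=> uh; rewrite {1}(rho_al s) (rho_be s); apply: cube_app => l.
have [ab|] := eqVneq (al s l) (be s l); last exact: cube_pw_neq.
by rewrite -ab; apply: uh.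
Qed.

(* Writing [w = rho g] as [T] of words in [g] and [swap g] on one side and using
   an identity on the other two, [cube w w w] reduces to [cube w w g] and
   [cube w w (swap g)], hence to the entries of [g] that are placed on the
   equality sets of the first two identities; the other two identities provide
   [cube a a g] and [cube f g a]. *)
Lemma cube_free : exists f, cube f f f.
Proof.
pose s1 := (true, true); pose s2 := (true, false).
pose s3 := (false, true); pose s4 := (false, false).
have neq s s' l : al s l = be s l -> s != s' -> (al s' l == be s' l) = false.
  by move=> sl; apply: contraNF => /eqP /(disjoint sl) ->.
pose v := rho (proj true).
(* The entries of [b] oppose those of [v] on the equality set of [s1] and those of [swap v] on that
   of [s2]. *)
pose b := app T (fun l => if al s1 l == be s1 l then proj (~~ al s1 l)
                          else proj (al s2 l)).
have vvb c : cube (pw v c) (pw v c) b.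
  rewrite rho_pw; case: c.
    apply: (cube_rho (s := s1)) => l s1l; rewrite s1l eqxx !pw_proj.
    by apply: cube_proj; case: (be _ _).
  apply: (cube_rho (s := s2)) => l s2l; rewrite (neq s2) // !pw_proj.
  by apply: cube_proj; case: (al _ _).
have vb c c' : cube (pw v c) (pw v c') b.
  by have [->|] := eqVneq c c'; [apply: vvb|apply: cube_pw_neq].
pose u := rho v; pose a := rho u.
have ub c c' : cube (pw u c) (pw u c') b.
  have [->|] := eqVneq c c'; last exact: cube_pw_neq.
  rewrite rho_pw (rho_al s1) -[b](app_const hA T); apply: cube_app => l.
  by case: c' => //=; rewrite pw_swap.
(* On the equality set of [s3] the entries of [f] give [uf]; elsewhere they are opposite to those of
   [a], as [fga] requires. *)
pose f := app T (fun l => if al s3 l == be s3 l then b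
                          else pw u (~~ al s1 l)).
have uf c : cube (pw u c) (pw u c) f.
  rewrite rho_pw; apply: (cube_rho (s := s3)) => l s3l; rewrite s3l eqxx.
  by case: c => //=; rewrite pw_swap.
(* The equality sets of [s1] and [s2] serve [wwg] and [wwg'], that of [s4] gives [aag], and [swap a]
   on that of [s3] gives [fga]. *)
pose g := app T (fun l =>
  if al s1 l == be s1 l then pw a (al s1 l)
  else if al s2 l == be s2 l then pw a (~~ al s2 l)
  else if al s4 l == be s4 l then f else swap a).
have fga : cube f g a.
  rewrite [a](rho_al s1); apply: cube_app => l.
  have [s3l|_] := eqVneq (al s3 l) (be s3 l); last first.
    by apply/cube_rot/cube_pw_neq; case: (al _ _).
  rewrite !(neq s3) //; apply/cube_rot/cube_rot.
  rewrite [swap a](rho_pw u false) (rho_al s1) /= -[b](app_const hA T).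
  rewrite -[pw u (al s1 l)](app_const hA T); apply: cube_app => l'.
  by rewrite pw_swap.
have aag : cube a a g.
  apply: (cube_rho (s := s4)) => l s4l.
  by rewrite (neq s4 s1) // (neq s4 s2) // s4l eqxx.
have gga : cube g g a.
  (* Every entry of the first [g] is [a], [swap a] or [f], and each of these forms a cube with [g]
     and [a]. *)
  rewrite {1}/g -[g in X in cube _ X _](app_const hA T).
  rewrite -[a in X in cube _ _ X](app_const hA T).
  have ga c : cube (pw a c) g a.
    by case: c => /=; apply: cube_rot => //; apply: cube_swapl.
  by apply: cube_app => l; do 3?case: ifP => _ //; apply: (ga false).
have ggaE c : cube (pw g c) (pw g c) (pw a c).
  by case: c => //=; apply: cube_swap.
have wwg : cube (rho g) (rho g) g.
  by apply: (cube_rho (s := s1)) => l s1l; rewrite s1l eqxx.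
have wwg' : cube (rho g) (rho g) (swap g).
  rewrite [swap g]swap_app; apply: (cube_rho (s := s2)) => l s2l.
  by rewrite (neq s2 s1) // s2l eqxx swap_pw negbK.
exists (rho g); rewrite [X in cube _ _ X](rho_al s1).
by apply: cube_app3 => l; case: (al _ _).
Qed.

End DisjointIdentities.

End WeakCube.

(** * The equivalent conditions *)

Section Equivalences.

Variables (Sg : signature) (A : algebra Sg).
Hypothesis hA : idempotent_algebra A.

(* The rows of the double loop and weak 3-cube identities, with [x] and [y]
   encoded as [true] and [false]. *)
Definition row1 := [tuple true; true; true; true; true; true;
  false; false; false; false; false; false].
Definition row2 := [tuple true; true; false; false; false; false;
  true; true; true; true; false; false].
Definition row3 := [tuple true; false; true; true; false; false;
  true; true; false; false; true; false].
Definition row4 := [tuple false; true; true; false; true; false;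
  true; false; true; false; false; true].

Lemma rows_neq i :
  (tnth row1 i != tnth row2 i) || (tnth row3 i != tnth row4 i).
Proof. by case: i; do 12?[case=> //]. Qed.

Lemma rows_complete a b c d : (a != b) || (c != d) ->
  exists i, [/\ tnth row1 i = a, tnth row2 i = b, tnth row3 i = c
              & tnth row4 i = d].
Proof.
case: a b c d => -[] [] [] // _;
  [exists (@Ordinal 12 0 isT)|exists (@Ordinal 12 1 isT)
  |exists (@Ordinal 12 2 isT)|exists (@Ordinal 12 3 isT)
  |exists (@Ordinal 12 4 isT)|exists (@Ordinal 12 5 isT)
  |exists (@Ordinal 12 6 isT)|exists (@Ordinal 12 7 isT)
  |exists (@Ordinal 12 8 isT)|exists (@Ordinal 12 9 isT)
  |exists (@Ordinal 12 10 isT)|exists (@Ordinal 12 11 isT)]; by split.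
Qed.

Definition cube1 := [tuple true; false; false; false; true; true].
Definition cube2 := [tuple false; true; false; true; false; true].
Definition cube3 := [tuple false; false; true; true; true; false].

Lemma cubes_complete a b c : ~~ ((a == b) && (b == c)) ->
  exists i, [/\ tnth cube1 i = a, tnth cube2 i = b & tnth cube3 i = c].
Proof.
case: a b c => -[] [] // _;
  [exists (@Ordinal 6 5 isT)|exists (@Ordinal 6 4 isT)
  |exists (@Ordinal 6 0 isT)|exists (@Ordinal 6 3 isT)
  |exists (@Ordinal 6 1 isT)|exists (@Ordinal 6 2 isT)]; by split.
Qed.

Definition tapp (n : nat) (t : term Sg 'I_n) (r : n.-tuple bool) : bfun A :=
  app t (fun i => proj A (tnth r i)).

Lemma tapp_subst (n : nat) (X : finType) (T : term Sg X) D
    (r : n.-tuple bool) :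
  tapp (subst D T) r = app T (fun i => tapp (D i) r).
Proof. by apply: bfunP => x y /=; rewrite eval_subst. Qed.

Lemma tapp_Var (n : nat) (i : 'I_n) r : tapp (Var Sg i) r = proj A (tnth r i).
Proof. exact: bfunP. Qed.

Lemma dbl_term f g h k : dbl f g h k -> exists d : term Sg 'I_12,
  [/\ f = tapp d row1, g = tapp d row2, h = tapp d row3 & k = tapp d row4].
Proof.
elim=> [a b c d /rows_complete[i [<- <- <- <-]]|X T u1 u2 u3 u4 _ IH].
  by exists (Var Sg i); split; rewrite tapp_Var.
have {IH}/fin_all_exists[D HD] := IH.
by exists (subst D T); split; rewrite tapp_subst; apply: app_ext => i;
  have [] := HD i.
Qed.

Lemma cube_term f g h : cube f g h -> exists t : term Sg 'I_6,
  [/\ f = tapp t cube1, g = tapp t cube2 & h = tapp t cube3].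
Proof.
elim=> [a b c /cubes_complete[i [<- <- <-]]|X T u1 u2 u3 _ IH].
  by exists (Var Sg i); split; rewrite tapp_Var.
have {IH}/fin_all_exists[D HD] := IH.
by exists (subst D T); split; rewrite tapp_subst; apply: app_ext => i;
  have [] := HD i.
Qed.

Lemma tapp_tuple (n : nat) (t : term Sg 'I_n) (r : n.-tuple bool) x y
    (a : n.-tuple A) :
  map_tuple (fun b : bool => if b then x else y) r = a ->
  sval (tapp t r) x y = Defs.tval t a.
Proof. by move=> <-; apply: eval_ext => i; rewrite tnth_map. Qed.

Lemma row1E (t : term Sg 'I_12) x y :
  sval (tapp t row1) x y
    = Defs.tval t [tuple x; x; x; x; x; x; y; y; y; y; y; y].
Proof. exact/tapp_tuple/val_inj. Qed.

Lemma row2E (t : term Sg 'I_12) x y :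
  sval (tapp t row2) x y
    = Defs.tval t [tuple x; x; y; y; y; y; x; x; x; x; y; y].
Proof. exact/tapp_tuple/val_inj. Qed.

Lemma row3E (t : term Sg 'I_12) x y :
  sval (tapp t row3) x y
    = Defs.tval t [tuple x; y; x; x; y; y; x; x; y; y; x; y].
Proof. exact/tapp_tuple/val_inj. Qed.

Lemma row4E (t : term Sg 'I_12) x y :
  sval (tapp t row4) x y
    = Defs.tval t [tuple y; x; x; y; x; y; x; y; x; y; y; x].
Proof. exact/tapp_tuple/val_inj. Qed.

Lemma cube1E (t : term Sg 'I_6) x y :
  sval (tapp t cube1) x y
    = Defs.tval t [tuple x; y; y; y; x; x].
Proof. exact/tapp_tuple/val_inj. Qed.

Lemma cube2E (t : term Sg 'I_6) x y :
  sval (tapp t cube2) x y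
    = Defs.tval t [tuple y; x; y; x; y; x].
Proof. exact/tapp_tuple/val_inj. Qed.

Lemma cube3E (t : term Sg 'I_6) x y :
  sval (tapp t cube3) x y
    = Defs.tval t [tuple y; y; x; x; x; y].
Proof. exact/tapp_tuple/val_inj. Qed.

Lemma taylor_term_double_loop : has_taylor_term A -> has_double_loop_term A.
Proof.
move=> /(double_loop_free hA)[p [q /dbl_term[d [p1 p2 q3 q4]]]].
by exists d => x y; rewrite -row1E -row2E -row3E -row4E -p1 -p2 -q3 -q4.
Qed.

Lemma double_loop_strong :
  has_double_loop_term A -> has_strong_double_loop_term A.
Proof.
move=> [d dP].
have d12 : tapp d row1 = tapp d row2.
  by apply: bfunP => x y; rewrite row1E row2E; have [] := dP x y.
have d34 : tapp d row3 = tapp d row4.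
  by apply: bfunP => x y; rewrite row3E row4E; have [] := dP x y.
have : dbl (tapp d row1) (tapp d row1) (tapp d row3) (tapp d row3).
  rewrite {2}d12 {2}d34; apply: dbl_app => i.
  exact/dbl_proj/rows_neq.
move=> /(strong_double_loop_free hA)[r /dbl_term[e [r1 r2 r3 r4]]].
by exists e => x y; rewrite -row1E -row2E -row3E -row4E -r1 -r2 -r3 -r4.
Qed.

(* Each identity on [star d d] compares two rows on the outer copy of [d], and
   two rows on the inner copy wherever the outer ones agree. *)
Lemma strong_double_loop_weak_3cube :
  has_strong_double_loop_term A -> has_weak_3cube_term A.
Proof.
move=> [d dP].
pose R (s o : bool) := tnth (if s then if o then row1 else row2
                             else if o then row3 else row4).
pose p x y := sval (tapp d row1) x y.
have Rp s o x y : eval (two_valued (R s o) x y) d = p x y.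
  have [e12 e23 e34] := dP x y.
  have -> : p x y = sval (tapp d (if s then if o then row1 else row2
                             else if o then row3 else row4)) x y.
    by case: s o => -[]; rewrite /p row1E ?row2E ?row3E ?row4E ?e12 ?e23 ?e34.
  exact: eval_ext.
pose al (s : bool * bool) (l : 'I_12 * 'I_12) :=
  R s.1 true l.1 == R s.2 true l.2.
pose be (s : bool * bool) (l : 'I_12 * 'I_12) :=
  R s.1 false l.1 == R s.2 (R s.1 true l.1 != R s.1 false l.1) l.2.
(* The inner row may depend on the outer coordinate because all four rows give the same value
   [p]. *)
have pis s1 o1 s2 (o2 : 'I_12 -> bool) x y :
    eval (two_valued (fun l => R s1 o1 l.1 == R s2 (o2 l.1) l.2) x y)
      (star d d) = p (p x y) (p y x).
  rewrite eval_star -(Rp s1 o1); apply: eval_ext => i /=.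
  rewrite -(Rp s2 (o2 i)) -[in RHS](Rp s2 (o2 i)) /two_valued.
  case: (R s1 o1 i); apply: eval_ext => j; first by case: (R s2 _ j).
  by case: (R s2 _ j).
pose rho (u : bfun A) := app (star d d) (fun l => pw u (al (true, true) l)).
have rhoE s1 o1 s2 (o2 : 'I_12 -> bool) (u : bfun A) : rho u =
    app (star d d) (fun l => pw u (R s1 o1 l.1 == R s2 (o2 l.1) l.2)).
  apply: bfunP => x y /=.
  transitivity (p (p (sval u x y) (sval u y x)) (p (sval u y x) (sval u x y))).
    rewrite -(pis true true true (fun _ => true)); apply: eval_ext => l.
    by rewrite /al /two_valued /=; case: ifP.
  rewrite -(pis s1 o1 s2 o2); apply: eval_ext => l.
  by rewrite /two_valued /=; case: ifP.
have [||s s' l|f /cube_term[t [t1 t2 t3]]] :=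
    @cube_free _ _ hA _ (star d d) rho al be.
- by move=> s u; apply: (rhoE s.1 true s.2 (fun _ => true)).
- move=> s u.
  exact: (rhoE s.1 false s.2 (fun i => R s.1 true i != R s.1 false i)).
(* The sides of identity [s0] agree at [l] only if both its outer and its inner row pairs agree. No
   column has both pairs agreeing, so [l] determines [s0]. *)
- have rn i : (R true true i != R true false i)
             || (R false true i != R false false i) by exact: rows_neq.
  have agree s0 : al s0 l = be s0 l ->
     R s0.1 true l.1 = R s0.1 false l.1 /\ R s0.2 true l.2 = R s0.2 false l.2.
    rewrite /al /be; have [->|] := eqVneq (R s0.1 true l.1) (R s0.1 false l.1).
      by move=> H; split=> //; move: H; do 3?case: (R _ _ _).
    by do 3?case: (R _ _ _).
  move: s s' => [s1 s2] [s1' s2'] /agree /= [e1 e2] /agree /= [e1' e2'].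
  have := rn l.1; have := rn l.2.
  case: s1 s2 s1' s2' e1 e2 e1' e2' => -[] [] [] -> -> e1 e2 //=;
  by rewrite ?e1 ?e2 ?eqxx ?orbT.
- by exists t => x y; rewrite -cube1E -cube2E -cube3E -t1 -t2 -t3.
Qed.

End Equivalences.

(** * Identification of variables *)

Section Minors.

Variables (Sg : signature) (A : algebra Sg).

Definition minor (n k : nat) (t : term Sg 'I_n) (r : n.-tuple 'I_k)
    : term Sg 'I_k :=
  subst (fun i => Var Sg (tnth r i)) t.

Lemma tval_minor (n k : nat) (t : term Sg 'I_n) (r : n.-tuple 'I_k)
    (a : k.-tuple A) :
  Defs.tval (minor t r) a = Defs.tval t (map_tuple (tnth a) r).
Proof.
by rewrite /Defs.tval eval_subst; apply: eval_ext => i; rewrite tnth_map.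
Qed.

Lemma tval_eq (n m : nat) (t : term Sg 'I_n) (t' : term Sg 'I_m)
    (a b : n.-tuple A) (a' b' : m.-tuple A) :
  Defs.tval t b = Defs.tval t' b' -> b = a :> seq A -> b' = a' :> seq A ->
  Defs.tval t a = Defs.tval t' a'.
Proof. by move=> tt' /val_inj <- /val_inj <-. Qed.

Local Notation o3 i := (@Ordinal 3 i isT).
Local Notation o4 i := (@Ordinal 4 i isT).

Lemma strong_double_loop_quaternary :
  has_strong_double_loop_term A -> has_linked_quaternary_terms A.
Proof.
move=> [d dP].
(* [q1] merges the coordinates of [d] with equal columns in the first two rows, [q2] those in the
   last two. [c] only records whether the first two rows agree, the last two agree, or neither pair
   does. *)
exists (minor d [tuple o4 2; o4 2; o4 0; o4 0; o4 0; o4 0;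
                       o4 1; o4 1; o4 1; o4 1; o4 3; o4 3]),
  (minor d [tuple o4 0; o4 1; o4 2; o4 0; o4 1; o4 3;
                  o4 2; o4 0; o4 1; o4 3; o4 0; o4 1]),
  (minor d [tuple o3 1; o3 1; o3 0; o3 2; o3 2; o3 0;
                  o3 0; o3 2; o3 2; o3 0; o3 1; o3 1]).
move=> x y; have [d12 d23 d34] := dP x y; rewrite !tval_minor.
split; [exact: (tval_eq d12)|exact: (tval_eq d23)|exact: (tval_eq d34)|..];
  exact: (tval_eq erefl).
Qed.

Lemma quaternary_strong_terminator :
  has_linked_quaternary_terms A -> has_strong_terminator_terms A.
Proof.
move=> [q1 [q2 [c cP]]]; exists c.
(* The [q1] identity becomes [c11(y,x,x) = c12(y,x,x)] and the [q2] identity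
   [c21(x,y,x) = c22(x,y,x)], so the common value of [q1] and [q2] links the branches. The other
   equations within the branches hold by construction. *)
exists (minor q1 [tuple o3 1; o3 0; o3 2; o3 2]),
  (minor q2 [tuple o3 1; o3 0; o3 2; o3 2]),
  (minor q1 [tuple o3 2; o3 0; o3 1; o3 0]),
  (minor q1 [tuple o3 0; o3 2; o3 1; o3 0]),
  (minor q2 [tuple o3 2; o3 1; o3 0; o3 1]),
  (minor q2 [tuple o3 1; o3 2; o3 0; o3 1]).
split=> [|x y]; last first.
  have [e1 e2 e3 _ _] := cP x y; rewrite !tval_minor.
  exact: (tval_eq (etrans e1 (etrans e2 e3))).
split=> x y; have [e1 e2 e3 e4 e5] := cP x y; rewrite !tval_minor.
- by split; [exact: (tval_eq (esym e4))|exact: (tval_eq (esym e5))].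
- by split; first [exact: (tval_eq erefl)|exact: (tval_eq e1)].
- by split; first [exact: (tval_eq erefl)|exact: (tval_eq e3)].
Qed.

(** No column of the three rows is constant, so each coordinate is separated by one of the two
    identities. *)
Lemma weak_3cube_taylor_term : has_weak_3cube_term A -> has_taylor_term A.
Proof.
move=> [t tP]; exists 'I_6, t => i.
have : (tnth cube1 i != tnth cube2 i) || (tnth cube2 i != tnth cube3 i).
  by case: i; do 6?[case=> //].
case/orP=> ne.
  exists (tnth cube1), (tnth cube2); split=> // x y.
  by have [+ _] := tP x y; rewrite -cube1E -cube2E.
exists (tnth cube2), (tnth cube3); split=> // x y.
by have [_ +] := tP x y; rewrite -cube2E -cube3E.
Qed.

End Minors.

(** * Terminator terms as a nontrivial idempotent condition *)

Section TerminatorsAreTaylor.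

Let Dl := @Signature 'I_7 (fun _ => 3).

Definition ternary (f : 'I_7) (r : 3.-tuple nat) : term Dl nat :=
  @App Dl nat f [ffun i : 'I_3 => Var Dl (tnth r i)].

Local Notation o7 i := (@Ordinal 7 i isT).

(* The symbols 0, ..., 6 stand for c, c1, c2, c11, c12, c21, c22. *)
Definition terminator_equations : seq (term Dl nat * term Dl nat) :=
  [:: (ternary (o7 0) [tuple 0; 1; 0], ternary (o7 1) [tuple 0; 0; 1]);
      (ternary (o7 0) [tuple 1; 0; 0], ternary (o7 2) [tuple 0; 0; 1]);
      (ternary (o7 1) [tuple 0; 1; 0], ternary (o7 3) [tuple 0; 0; 1]);
      (ternary (o7 1) [tuple 1; 0; 0], ternary (o7 4) [tuple 0; 0; 1]);
      (ternary (o7 3) [tuple 0; 1; 0], ternary (o7 4) [tuple 0; 1; 0]);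
      (ternary (o7 3) [tuple 1; 0; 0], ternary (o7 4) [tuple 1; 0; 0]);
      (ternary (o7 2) [tuple 0; 1; 0], ternary (o7 5) [tuple 0; 0; 1]);
      (ternary (o7 2) [tuple 1; 0; 0], ternary (o7 6) [tuple 0; 0; 1]);
      (ternary (o7 5) [tuple 0; 1; 0], ternary (o7 6) [tuple 0; 1; 0]);
      (ternary (o7 5) [tuple 1; 0; 0], ternary (o7 6) [tuple 1; 0; 0])].

(** Idempotence of every symbol is included among the equations, so the condition is idempotent
    outright. *)
Definition terminator_condition : condition Dl := fun s t =>
  List.In (s, t) terminator_equations \/
  exists f : 'I_7, s = @App Dl nat f [ffun=> Var Dl 0] /\ t = Var Dl 0.

Lemma eval_ternary (Sg : signature) (A : algebra Sg) (I : interpretation Dl Sg)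
    (e : nat -> A) f r :
  eval e (translate I (ternary f r)) = Defs.tval (I f) (map_tuple e r).
Proof.
by rewrite /= eval_subst; apply: eval_ext => i; rewrite ffunE tnth_map.
Qed.

Lemma term_no_symbols (Sg : signature) (V : Type) (t : term Sg V) :
  (Sg -> False) -> exists v, t = Var Sg v.
Proof. by move=> NSg; case: t => [v|f]; [exists v|case: (NSg f)]. Qed.

(** In the two-element algebra without operations every symbol becomes a projection. Each branch
    forces its root onto the third coordinate, and then [c] would have to project onto both the
    first and the second. *)
Lemma terminator_condition_nontrivial :
  ~ trivial_condition terminator_condition.
Proof.
pose Sg0 := @Signature void (fun _ => 0).
pose B := @Algebra Sg0 bool (fun f => match f with end).
move=> /(_ Sg0 B)[I IP].
have /fin_all_exists[v vP] (f : 'I_7) : exists v : 'I_3, I f = Var Sg0 v.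
  by apply: term_no_symbols => -[].
have eqn p : List.In p terminator_equations ->
    satisfies B (translate I p.1) (translate I p.2).
  by case: p => s t st; apply: IP; left.
pose e (n : nat) : B := n == 1.
have H f r g r' : List.In (ternary f r, ternary g r') terminator_equations ->
    e (tnth r (v f)) = e (tnth r' (v g)).
  by move=> /eqn /(_ e); rewrite !eval_ternary !vP /Defs.tval /= !tnth_map.
have E100 i : e (tnth [tuple 1; 0; 0] i) = (i == 0 :> nat).
  by case: i; do 3?[case=> //].
have E010 i : e (tnth [tuple 0; 1; 0] i) = (i == 1 :> nat).
  by case: i; do 3?[case=> //].
have E001 i : e (tnth [tuple 0; 0; 1] i) = (i == 2 :> nat).
  by case: i; do 3?[case=> //].
have branch (i j k : 'I_3) : (i == 1 :> nat) = (j == 2 :> nat) ->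
    (i == 0 :> nat) = (k == 2 :> nat) -> (j == 1 :> nat) = (k == 1 :> nat) ->
    (j == 0 :> nat) = (k == 0 :> nat) -> i == 2 :> nat.
  by case: i j k => -[|[|[|]]] // ? [] [|[|[|]]] // ? [] [|[|[|]]].
have i1 : v (o7 1) == 2 :> nat.
  apply: (branch _ (v (o7 3)) (v (o7 4))); rewrite -?E010 -?E001 -?E100;
    apply: H; rewrite /=; tauto.
have i2 : v (o7 2) == 2 :> nat.
  apply: (branch _ (v (o7 5)) (v (o7 6))); rewrite -?E010 -?E001 -?E100;
    apply: H; rewrite /=; tauto.
have : (v (o7 0) == 1 :> nat) = (v (o7 1) == 2 :> nat).
  by rewrite -E010 -E001; apply: H; rewrite /=; tauto.
have : (v (o7 0) == 0 :> nat) = (v (o7 2) == 2 :> nat).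
  by rewrite -E100 -E001; apply: H; rewrite /=; tauto.
by rewrite i1 i2 => /eqP ->.
Qed.

Lemma terminator_taylor (Sg : signature) (A : algebra Sg) :
  idempotent_algebra A -> has_terminator_terms A -> taylor A.
Proof.
move=> hA [c [c1 [c2 [c11 [c12 [c21 [c22 [cP c1P c2P]]]]]]]].
exists Dl, terminator_condition; split.
- by move=> f _ B BS e; apply: (BS _ _ _ e); right; exists f.
- exact: terminator_condition_nontrivial.
- pose I := tnth [tuple c; c1; c2; c11; c12; c21; c22].
  exists (fun f : Dl => I f) => s t.
  case=> [|[f [-> ->]] e]; last first.
    rewrite -[RHS](@eval_const _ _ hA 'I_3 _ (I f)).
    by rewrite /= eval_subst; apply: eval_ext => i; rewrite ffunE.
  case=> [[<- <-] e|]; first by have [E _] := cP (e 0) (e 1);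
    rewrite !eval_ternary; apply: (tval_eq E).
  case=> [[<- <-] e|]; first by have [_ E] := cP (e 0) (e 1);
    rewrite !eval_ternary; apply: (tval_eq E).
  case=> [[<- <-] e|]; first by have [E _ _ _] := c1P (e 0) (e 1);
    rewrite !eval_ternary; apply: (tval_eq E).
  case=> [[<- <-] e|]; first by have [_ E _ _] := c1P (e 0) (e 1);
    rewrite !eval_ternary; apply: (tval_eq E).
  case=> [[<- <-] e|]; first by have [_ _ E _] := c1P (e 0) (e 1);
    rewrite !eval_ternary; apply: (tval_eq E).
  case=> [[<- <-] e|]; first by have [_ _ _ E] := c1P (e 0) (e 1);
    rewrite !eval_ternary; apply: (tval_eq E).
  case=> [[<- <-] e|]; first by have [E _ _ _] := c2P (e 0) (e 1);
    rewrite !eval_ternary; apply: (tval_eq E).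
  case=> [[<- <-] e|]; first by have [_ E _ _] := c2P (e 0) (e 1);
    rewrite !eval_ternary; apply: (tval_eq E).
  case=> [[<- <-] e|]; first by have [_ _ E _] := c2P (e 0) (e 1);
    rewrite !eval_ternary; apply: (tval_eq E).
  case=> [[<- <-] e|]; first by have [_ _ _ E] := c2P (e 0) (e 1);
    rewrite !eval_ternary; apply: (tval_eq E).
  by [].
Qed.

End TerminatorsAreTaylor.

Theorem theorem6p1 (Sg : signature) (A : algebra Sg)
  (hA : idempotent_algebra A) :
  [<-> taylor A;
       has_double_loop_term A;
       has_strong_double_loop_term A;
       has_weak_3cube_term A;
       has_linked_quaternary_terms A;
       has_terminator_terms A;
       has_strong_terminator_terms A].
Proof.
have taylor_quaternary : has_taylor_term A -> has_linked_quaternary_terms A.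
  move=> /(taylor_term_double_loop hA) /(double_loop_strong hA).
  exact: strong_double_loop_quaternary.
have strong_terminator :
    has_strong_terminator_terms A -> has_terminator_terms A.
  move=> [c [c1 [c2 [c11 [c12 [c21 [c22 [cP _]]]]]]]].
  by exists c, c1, c2, c11, c12, c21, c22.
tfae.
- by move=> /(taylor_has_taylor_term hA); apply: taylor_term_double_loop.
- exact: double_loop_strong.
- exact: strong_double_loop_weak_3cube.
- by move=> /weak_3cube_taylor_term.
- by move=> /quaternary_strong_terminator.
(* Terminators become strong by passing through a Taylor term and the linked quaternary terms. *)
- move=> /(terminator_taylor hA) /(taylor_has_taylor_term hA).
  by move=> /taylor_quaternary; apply: quaternary_strong_terminator.
- by move=> /strong_terminator; apply: terminator_taylor.
Qed.
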